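(* Let $\ell_1,\ell_2\in\{1,2\}$ and $k\in\mathbb{K}_N$, and let the forward operator $T_{k,\ell_1,\ell_2}:L^2(\Omega_0)\to\mathbb{R}^m$ satisfy, with $\Sigma=\Sigma_{k,\ell_1,\ell_2}$: (a) for every $\delta>0$ there exists $M_{k,\ell_1,\ell_2}=M_{k,\ell_1,\ell_2}(\delta)\in\mathbb{R}$ such that $\|T_{k,\ell_1,\ell_2}(\sigma^2)\|_{\Sigma}\le\exp(\delta\|\sigma^2\|^2_{L^2(\Omega_0)}+M_{k,\ell_1,\ell_2})$ for all $\sigma^2\in L^2(\Omega_0)$; (b) for every $r>0$ there exists $K_{k,\ell_1,\ell_2}=K_{k,\ell_1,\ell_2}(r)>0$ such that $\|T_{k,\ell_1,\ell_2}(\sigma_1^2)-T_{k,\ell_1,\ell_2}(\sigma_2^2)\|_{\Sigma}\le K_{k,\ell_1,\ell_2}\|\sigma_1^2-\sigma_2^2\|_{L^2(\Omega_0)}$ for all $\sigma_1^2,\sigma_2^2\in L^2(\Omega_0)$ with $\max\{\|\sigma_1^2\|_{L^2(\Omega_0)},\|\sigma_2^2\|_{L^2(\Omega_0)}\}<r$. For given data $F^\epsilon_{k,\ell_1,\ell_2}\in\mathbb{R}^m$, let $\mu^{F^\epsilon_{k,\ell_1,\ell_2}}$ be the posterior measure defined by $$\frac{d\mu^{F^\epsilon_{k,\ell_1,\ell_2}}}{d\mu_{pr}}(\sigma^2)\propto\exp\left(-\tfrac12\|T_{k,\ell_1,\ell_2}(\sigma^2)-F^\epsilon_{k,\ell_1,\ell_2}\|^2_{\Sigma}\right).$$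 Then: (i) $\mu^{F^\epsilon_{k,\ell_1,\ell_2}}$ is a well-defined probability measure on $L^2(\Omega_0)$. (ii) $\mu^{F^\epsilon_{k,\ell_1,\ell_2}}$ is Lipschitz in the data with respect to the Hellinger metric: for every $r>0$ there exists $C_{k,\ell_1,\ell_2}=C_{k,\ell_1,\ell_2}(r)>0$ such that for all $F^\epsilon_{k,\ell_1,\ell_2},F'^{,\epsilon}_{k,\ell_1,\ell_2}\in\mathbb{R}^m$ with $\max\{\|F^\epsilon_{k,\ell_1,\ell_2}\|_{\Sigma},\|F'^{,\epsilon}_{k,\ell_1,\ell_2}\|_{\Sigma}\}<r$, $$d_{Hell}(\mu^{F^\epsilon_{k,\ell_1,\ell_2}},\mu^{F'^{,\epsilon}_{k,\ell_1,\ell_2}})\le C_{k,\ell_1,\ell_2}\,\|F^\epsilon_{k,\ell_1,\ell_2}-F'^{,\epsilon}_{k,\ell_1,\ell_2}\|_{\Sigma}.$$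
   Context: Let $a>0$, $\Omega_0=(-a,a)^2$, $B_R=\{x\in\mathbb{R}^2:|x|<R\}$ with $\Omega_0\subset\subset B_R$. The symbol $\sigma^2$ (and $\sigma_1^2,\sigma_2^2$) denotes a generic element of $L^2(\Omega_0)$, the argument of the linear operator below. $\Sigma_{k,\ell_1,\ell_2}$ is the (symmetric positive definite) covariance matrix of the Gaussian noise $\eta_{k,\ell_1,\ell_2}\sim\mathcal{N}(0,\Sigma_{k,\ell_1,\ell_2})$ in the model $F^\epsilon_{k,\ell_1,\ell_2}=T_{k,\ell_1,\ell_2}(\sigma^2)+\eta_{k,\ell_1,\ell_2}$, and $\|v\|_{\Sigma}=\|\Sigma^{-1/2}v\|_2$ for $v\in\mathbb{R}^m$. The prior $\mu_{pr}$ is a Gaussian measure on the separable Hilbert space $L^2(\Omega_0)$. Forward operator: $G_k(x,y)=-\frac{\mathrm i}{4}H_0^{(1)}(k|x-y|)$, $H_0^{(1)}=J_0+\mathrm iY_0$; $\mathbb{K}_N=\{\frac{\pi}{a}t:t\in\mathbb{R},t\ge1\}\cup\{k^*\}$ with $k^*>0$, $0<k^*R<1$. With $m$ a positive integer and $\nu_s=s\pi/m$, for $j=1,\dots,m$ let $\partial B_j=\{R(\cos\theta,\sin\theta):\nu_{2j-2}\le\theta\le\nu_{2j}\}$, $z_{j,\ell}=\lambda_{j,\ell}R(\cos\nu_{2j-1},\sin\nu_{2j-1})$ ($\ell=1,2$), and fix a measurement point $x_j\in\partial B_j$; $r_{j,\ell}=|x_j-z_{j,\ell}|$. Here the $\lambda_{j,\ell}\in\mathbb{R}$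 either satisfy $\sqrt2a/R\le|\lambda_{j,\ell}|<1$, or are chosen by the paper's explicit rule: $m\ge10$, $k^*=\frac{\pi}{30a}$, $\lambda_{j,1}=\frac12$; $R=\tau a$ ($\tau\ge6$), $\lambda_{j,2}=\frac12+\frac{\pi}{2kR}$ if $k\ne k^*$; $R=6a$, $\lambda_{j,2}=-\frac32$ if $k=k^*$. Then $T_{k,\ell_1,\ell_2}(\sigma^2)=(T_{1,k,\ell_1,\ell_2}(\sigma^2),\dots,T_{m,k,\ell_1,\ell_2}(\sigma^2))^\top$ with $$\begin{aligned}T_{j,k,\ell_1,\ell_2}(\sigma^2)=\;&Y_0(kr_{j,\ell_1})Y_0(kr_{j,\ell_2})\int_{\Omega_0}|\operatorname{Re}G_k(x_j,y)|^2\sigma^2(y)\,\mathrm dy+J_0(kr_{j,\ell_1})J_0(kr_{j,\ell_2})\int_{\Omega_0}|\operatorname{Im}G_k(x_j,y)|^2\sigma^2(y)\,\mathrm dy\\&-\left(Y_0(kr_{j,\ell_1})J_0(kr_{j,\ell_2})+Y_0(kr_{j,\ell_2})J_0(kr_{j,\ell_1})\right)\int_{\Omega_0}\operatorname{Re}G_k(x_j,y)\operatorname{Im}G_k(x_j,y)\sigma^2(y)\,\mathrm dy.\end{aligned}$$ Hellinger metric: for probability measures $\mu,\mu'$ on $L^2(\Omega_0)$ absolutely continuous with respect to a common reference measure $\nu$, $$d_{Hell}(\mu,\mu')=\sqrt{\frac12\int_{L^2(\Omega_0)}\left(\sqrt{\frac{d\mu}{d\nu}}-\sqrt{\frac{d\mu'}{d\nu}}\right)^2d\nu}.$$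 *)

(* Defs.v *)
From HB Require Import structures.
From mathcomp Require Import all_boot all_order all_algebra complex.
From mathcomp Require Import all_classical all_reals all_analysis.
From mathcomp Require Import measurable_realfun.
Set Implicit Arguments.
Unset Strict Implicit.
Unset Printing Implicit Defensive.
Import Order.TTheory GRing.Theory Num.Theory.
Import numFieldNormedType.Exports.
Local Open Scope classical_set_scope.
Local Open Scope ring_scope.
Local Open Scope charge_scope.
Local Open Scope quotient_scope.

(* The library provides the carrier LspaceType2 of L^2 (classes of measurable
   functions modulo a.e. equality) without algebraic structure; here it is made
   a normed space, with operations computed on representatives. *)
Section L2_space.
Context d (T : measurableType d) (R : realType).
Variables (mu : {measure set T -> \bar R}).
Local Notation p1 := (lee1n 2).
Local Notation L2 := (LspaceType2 mu).
Local Notation Lf2 := (LfunType mu p1).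
Local Notation "'N2 f" := ('N[mu]_2%:R%:E[EFin \o f])%E (at level 10).

Lemma ae_Lnorm2 (f g : T -> R) :
  measurable_fun setT f -> measurable_fun setT g -> f = g %[ae mu] ->
  'N2 f = 'N2 g.
Proof.
move=> mf mg fg; rewrite unlock/=; congr (_ `^ _)%E.
have mn (h : T -> R) : measurable_fun setT h ->
    measurable_fun setT (fun x => `|(h x)%:E| `^ 2%:R)%E.
  move=> mh; apply: (measurableT_comp (@measurable_poweR R 2%:R)).
  apply: (@measurableT_comp _ _ _ _ _ _ (@abse R)) => //.
  exact/measurable_EFinP.
apply: ae_eq_integral => //; [exact: mn|exact: mn|].
exact: (ae_eq_comp (fun x : R => (`|x%:E| `^ 2%:R)%E) fg).
Qed.

Definition L2rep (f : L2) : T -> R := f.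

Lemma measurable_L2rep (f : L2) : measurable_fun setT (L2rep f).
Proof. exact: (measurable_funPT (repr (LebesgueSpace.sort f))). Qed.

Lemma L2rep_finite f : finite_norm mu 2%:R%:E (L2rep f).
Proof. exact: (@Lebesgue_finite _ _ _ _ _ _ f). Qed.

HB.instance Definition _ f :=
  isMeasurableFun.Build _ _ T R (L2rep f) (measurable_L2rep f).
HB.instance Definition _ f :=
  @isLfunction.Build d T R mu 2%:R%:E p1 (L2rep f) (L2rep_finite f).

Section L2class.
Variable g : Lf2.

Definition Lfun_measurableTypeR : T -> measurableTypeR R := g.

Let measurable_g : measurable_fun setT Lfun_measurableTypeR.
Proof. exact: (measurable_funPT g). Qed.

HB.instance Definition _ := isMeasurableFun.Build _ _ T (measurableTypeR R)
  Lfun_measurableTypeR measurable_g.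

Let c := \pi_({mfun_ mu, T >-> measurableTypeR R})
  (Lfun_measurableTypeR : {mfun T >-> measurableTypeR R}).

Let repr_c : (repr c : T -> R) = g %[ae mu].
Proof. by have /eqP := reprK c; rewrite eqmodE => /asboolP. Qed.

Let finite_c : finite_norm mu 2%:R%:E (repr c : T -> R).
Proof.
rewrite /finite_norm (ae_Lnorm2 _ _ repr_c) //; first exact: Lfunction_finite.
exact: measurable_funPT (repr c).
Qed.

Definition L2class : L2 := LebesgueSpace.Pack
  (LebesgueSpace.Class (@isFinLebesgue.Build d T R mu 2%:R%:E p1 c finite_c)).

Lemma L2classK : L2rep L2class = g %[ae mu].
Proof. exact: repr_c. Qed.

End L2class.

Lemma L2_ext (f g : L2) : L2rep f = L2rep g %[ae mu] -> f = g.
Proof.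
move=> fg.
have e : LebesgueSpace.sort f = LebesgueSpace.sort g.
  by rewrite -[LHS]reprK -[RHS]reprK; apply/eqmodP; exact/asboolP.
case: f g e {fg} => [f [[f0]]] [g [[g0]]]/= e.
subst; congr LebesgueSpace.Pack; congr LebesgueSpace.Class.
by congr isFinLebesgue.phant_Build; apply: Prop_irrelevance.
Qed.

Lemma eq_L2class (f g : Lf2) : f = g %[ae mu] -> L2class f = L2class g.
Proof.
move=> fg; apply: L2_ext; apply: (ae_eq_trans (L2classK f)).
exact: (ae_eq_trans fg (ae_eq_sym (L2classK g))).
Qed.

Lemma L2repK (f : L2) : L2class (L2rep f) = f.
Proof. by apply: L2_ext; exact: L2classK. Qed.

Lemma L2classW (P : L2 -> Prop) : (forall f, P (L2class f)) -> forall f, P f.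
Proof. by move=> h f; rewrite -(L2repK f). Qed.

HB.instance Definition _ := gen_eqMixin L2.
HB.instance Definition _ := gen_choiceMixin L2.

Definition L2add (f g : L2) := L2class ((L2rep f : Lf2) + (L2rep g : Lf2)).
Definition L2opp (f : L2) := L2class (- (L2rep f : Lf2)).
Definition L2zero := L2class 0.
Definition L2scale (a : R) (f : L2) := L2class (a *: (L2rep f : Lf2)).

Lemma L2class_add (f g : Lf2) :
  L2add (L2class f) (L2class g) = L2class (f + g).
Proof.
apply: eq_L2class; have := L2classK g; have := L2classK f => hf hg.
exact: (@comp_ae_eq2' _ _ _ mu setT _ _ _ +%R _ _ hf _ _ hg).
Qed.

Lemma L2class_opp (f : Lf2) : L2opp (L2class f) = L2class (- f).
Proof. by apply: eq_L2class; apply: (ae_eq_comp -%R); exact: L2classK. Qed.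

Lemma L2class_scale a (f : Lf2) : L2scale a (L2class f) = L2class (a *: f).
Proof. by apply: eq_L2class; apply: (ae_eq_comp ( *%R a)); exact: L2classK. Qed.

Let L2addA : associative L2add.
Proof.
elim/L2classW => f; elim/L2classW => g; elim/L2classW => h.
by rewrite !L2class_add addrA.
Qed.

Let L2addC : commutative L2add.
Proof.
by elim/L2classW => f; elim/L2classW => g; rewrite !L2class_add addrC.
Qed.

Let L2add0 : left_id L2zero L2add.
Proof. by elim/L2classW => f; rewrite L2class_add add0r. Qed.

Let L2addN : left_inverse L2zero L2opp L2add.
Proof. by elim/L2classW => f; rewrite L2class_opp L2class_add addNr. Qed.

HB.instance Definition _ :=
  GRing.isZmodule.Build L2 L2addA L2addC L2add0 L2addN.

Lemma L2classD (f g : Lf2) : L2class f + L2class g = L2class (f + g) :> L2.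
Proof. exact: L2class_add. Qed.

Let L2scaleA a b f : L2scale a (L2scale b f) = L2scale (a * b) f.
Proof. by elim/L2classW: f => f; rewrite !L2class_scale scalerA. Qed.

Let L2scale1 : left_id 1 L2scale.
Proof. by elim/L2classW => f; rewrite !L2class_scale scale1r. Qed.

Let L2scaleDr : right_distributive L2scale +%R.
Proof.
move=> a; elim/L2classW => f; elim/L2classW => g.
by rewrite !(L2class_scale, L2classD) scalerDr.
Qed.

Let L2scaleDl f : {morph L2scale^~ f : a b / a + b}.
Proof.
move=> a b; elim/L2classW: f => f /=.
by rewrite !(L2class_scale, L2classD) scalerDl.
Qed.

HB.instance Definition _ := GRing.Zmodule_isLmodule.Build R L2
  L2scaleA L2scale1 L2scaleDr L2scaleDl.

Definition L2norm (f : L2) : R := fine ('N2 f).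

Lemma L2norm_class (f : Lf2) : L2norm (L2class f) = fine ('N2 f).
Proof.
congr fine; apply: ae_Lnorm2; last exact: L2classK.
- exact: measurable_L2rep.
- exact: measurable_funPT.
Qed.

Let ler_L2normD f g : L2norm (f + g) <= L2norm f + L2norm g.
Proof.
elim/L2classW: f => f; elim/L2classW: g => g.
by rewrite L2classD !L2norm_class; exact: ler_LnormD.
Qed.

Let L2normZ a f : L2norm (a *: f) = `|a| * L2norm f.
Proof.
elim/L2classW: f => f; rewrite [_ *: _]L2class_scale !L2norm_class.
by have /= -> := LnormZ f a; rewrite -finite_norm_fine.
Qed.

Let L2norm_eq0 f : L2norm f = 0 -> f = 0.
Proof.
elim/L2classW: f => f; rewrite L2norm_class => /fine_Lnormr_eq0 f0.
exact: eq_L2class.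
Qed.

HB.instance Definition _ :=
  Lmodule_isNormed.Build R L2 ler_L2normD L2normZ L2norm_eq0.

Lemma L2_normE (f : L2) : `|f| = fine ('N2 f).
Proof. by []. Qed.

End L2_space.

Notation borel V := (g_sigma_algebraType (@open V)).

(* s = 0 is the degenerate Gaussian, for which normal_prob is not a
   probability. *)
Definition gaussian_measure (R : realType) (V : normedModType R)
    (P : probability (borel V) R) : Prop :=
  forall phi : {scalar V}, continuous (phi : V -> R) ->
  exists m s : R, 0 <= s /\
    forall A : set R, measurable A ->
      pushforward P phi A = if s == 0 then \d_m A else normal_prob m s A.

Section bessel.
Context (R : realType).
Implicit Types x : R.

(* series harmonic n is the n-th harmonic number, with value 0 at n = 0 *)
Definition euler_gamma : R := limn (fun n => series harmonic n - ln n%:R).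

Definition besselJ0 x : R :=
  limn (series (fun n : nat =>
    (-1) ^+ n / (n`!%:R ^+ 2) * (x / 2) ^+ n.*2)).

(* the classical expansion at 0, valid for 0 < x *)
Definition besselY0 x : R :=
  2 / pi * ((ln (x / 2) + euler_gamma) * besselJ0 x -
    limn (series (fun n : nat =>
      (-1) ^+ n * series harmonic n / (n`!%:R ^+ 2) * (x / 2) ^+ n.*2))).

Definition hankel1_0 x : R[i] := (besselJ0 x +i* besselY0 x)%C.

End bessel.

Section geometry.
Context (R : realType).
Implicit Types (a rad kstar k : R) (m : nat) (x y z : R * R).

Definition plane : Type := (measurableTypeR R * measurableTypeR R)%type.

Definition euclid_norm x : R := Num.sqrt (x.1 ^+ 2 + x.2 ^+ 2).

Definition Omega0 a : set (R * R) := `]- a, a[ `*` `]- a, a[.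

Definition disk rad : set (R * R) := [set x | euclid_norm x < rad].

Definition wavenumbers a kstar : set R :=
  [set pi / a * t | t in [set t | 1 <= t]] `|` [set kstar].

Definition polar rad (theta : R) : R * R := (rad * cos theta, rad * sin theta).

Definition angle m (s : nat) : R := s%:R * pi / m%:R.

(* Indices j = 1..m and l = 1, 2 are represented by 'I_m and 'I_2, hence
   shifted by one: nu_{2j-2}, nu_{2j-1}, nu_{2j} become angle m at 2j, 2j+1,
   2j+2. *)
Definition boundary_arc rad m (j : 'I_m) : set (R * R) :=
  [set polar rad theta | theta in `[angle m j.*2, angle m j.*2.+2]].

Definition ref_point rad m (lam : 'I_m -> 'I_2 -> R) (j : 'I_m) (l : 'I_2) :
    R * R :=
  (lam j l * rad * cos (angle m j.*2.+1),
   lam j l * rad * sin (angle m j.*2.+1)).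

(* The two admissible choices of the lambda_{j,l}. In the explicit rule the
   radius depends on k; its value 6a for k = kstar gives kstar * rad < 1. *)
Definition general_choice a rad kstar m (lam : 'I_m -> 'I_2 -> R) : Prop :=
  kstar * rad < 1 /\
  forall j l, Num.sqrt 2 * a / rad <= `|lam j l| < 1.

Definition explicit_choice a rad kstar k m (lam : 'I_m -> 'I_2 -> R) : Prop :=
  [/\ (10 <= m)%N, kstar = pi / (30 * a),
      forall j, lam j ord0 = 2^-1,
      k <> kstar -> (exists2 tau, 6 <= tau & rad = tau * a) /\
        forall j, lam j ord_max = 2^-1 + pi / (2 * k * rad) &
      k = kstar -> rad = 6 * a /\ forall j, lam j ord_max = - (3 / 2)].

Definition green k x y : R[i] :=
  (- ('i / 4%:R) * hankel1_0 (k * euclid_norm (x - y)))%C.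

Lemma measurable_Omega0 a : measurable (Omega0 a : set plane).
Proof. by apply: measurableX; exact: measurable_itv. Qed.

Definition lebesgue2 : {measure set plane -> \bar R} :=
  (lebesgue_measure \x lebesgue_measure)%E.

(* L^2(Omega0), as L^2 of the plane for the restriction of Lebesgue measure to
   Omega0 *)
Definition L2Omega a : normedModType R :=
  LspaceType2 (mrestr lebesgue2 (measurable_Omega0 a)).

End geometry.

Section noise_norm.
Context (R : realType) (m : nat).
Implicit Types (A S : 'M[R]_m) (v : 'cV[R]_m).

Definition spd A : Prop :=
  A^T = A /\ forall v, v != 0 -> 0 < (v^T *m A *m v) ord0 ord0.

(* the symmetric positive definite S with S ^ 2 = A^-1, for A symmetric
   positive definite *)
Definition inv_sqrtmx A : 'M[R]_m := xget 0 [set S | spd S /\ S *m S = invmx A].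

Definition norm2 v : R := Num.sqrt (\sum_i v i ord0 ^+ 2).

Definition cov_norm A v : R := norm2 (inv_sqrtmx A *m v).

End noise_norm.

(* inv_sqrtmx is well defined: the square root exists (a polynomial in A^-1, by
   the spectral theorem) and is unique. *)
Section inv_sqrtmx_wf.
Context (R : realType).
Local Notation toC := (real_complex R).
Local Open Scope sesquilinear_scope.

Lemma spd_unit m (A : 'M[R]_m) : spd A -> A \in unitmx.
Proof.
move=> [As Ap]; rewrite -row_free_unit -kermx_eq0.
apply/rowV0P => v /sub_kermxP vA.
apply/eqP; apply: contraT => v0.
have := Ap v^T; rewrite trmx_eq0 trmxK vA mul0mx mxE ltxx; exact.
Qed.

Lemma spd_inv m (A : 'M[R]_m) : spd A -> spd (invmx A).
Proof.
move=> sA; have uA := spd_unit sA; case: sA => As Ap.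
split; first by rewrite trmx_inv As.
move=> v v0; have := Ap (invmx A *m v).
rewrite trmx_mul trmx_inv As mulmxKV// mulmxA; apply.
by apply: contra_neq v0 => /(congr1 (mulmx A)); rewrite mulKVmx// mulmx0.
Qed.

Lemma interp (f : R -> R) (s : seq R) :
  exists q : {poly R}, {in s, forall x, q.[x] = f x}.
Proof.
elim: s => [|x s [q qf]]; first by exists 0.
have [xs|xs] := boolP (x \in s).
  by exists q => y; rewrite inE => /orP[/eqP->|]; exact: qf.
pose w := \prod_(y <- s) ('X - y%:P).
have wx : w.[x] != 0 by rewrite -rootE root_prod_XsubC.
exists (q + ((f x - q.[x]) / w.[x]) *: w) => y; rewrite inE => /orP[/eqP->|ys].
  by rewrite hornerD hornerZ divfK// addrC subrK.
have /rootP wy : root w y by rewrite root_prod_XsubC.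
by rewrite hornerD hornerZ wy mulr0 addr0 qf.
Qed.

Lemma tr_horner n (B : 'M[R]_n.+1) p : (horner_mx B p)^T = horner_mx B^T p.
Proof.
elim/poly_ind: p => [|p c IH]; first by rewrite !rmorph0 trmx0.
rewrite !(rmorphD, rmorphM)/= !horner_mx_X !horner_mx_C linearD/= tr_scalar_mx.
rewrite trmx_mul IH; congr (_ + _).
have /= := @comm_horner_mx _ _ B^T B^T p erefl.
by move=> h; exact/esym.
Qed.

Lemma spd_spectral n (B : 'M[R]_n) : spd B ->
  exists (P : 'M[R[i]]_n) (d : 'rV[R]_n),
  [/\ P \in unitmx, forall i, 0 <= d 0 i &
      map_mx toC B = invmx P *m diag_mx (map_mx toC d) *m P].
Proof.
move=> [Bs Bp]; pose BC := map_mx toC B.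
have BCs : BC \is symmetricmx.
  apply/is_hermitianmxP; rewrite expr0 scale1r; apply/matrixP => i j.
  by rewrite !mxE -{1}Bs mxE.
have BCr : BC \is a realmx by apply/mxOverP => i j; rewrite mxE complex_real.
have BCh := realsym_hermsym BCs BCr.
have dr := hermitian_spectral_diag_real BCh.
have /orthomx_spectralP BE := hermitian_normalmx BCh.
set P := spectralmx BC in BE; set d := spectral_diag BC in BE dr.
have uP : P \in unitmx := spectral_unit BC.
have PP : P *m P^t* = 1%:M by apply/unitarymxP; exact: spectral_unitarymx.
clearbody P d; clear BCh BCr BCs.
pose dR := map_mx (@complex.Re R) d.
have dE : d = map_mx toC dR.
  apply/rowP => i; rewrite !mxE; have := mxOverP dr 0 i.
  case: (d 0 i) => p q; rewrite realE !lecE/=.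
  by move=> /orP[]/andP[/eqP + _] => [->|<-].
exists P, dR; split; [exact: uP| |by rewrite -dE; exact: BE].
move=> i.
pose w := row i P.
have e1 : (w *m BC *m (w^t*)) 0 0 = d 0 i.
  have -> : w *m BC = d 0 i *: w.
    rewrite BE /w !mulmxA -row_mul mulmxV// row1 -!mulmxA mul_diag_mx -rowE.
    by apply/rowP => j; rewrite !mxE.
  rewrite -scalemxAl mxE (_ : (w *m w^t*) 0 0 = 1) ?mulr1//.
  have /matrixP/(_ i i) := PP.
  rewrite !mxE eqxx => h; apply: etrans h.
  by apply: eq_bigr => k _; rewrite !mxE.
pose u := map_mx (@complex.Re R) w; pose v := map_mx (@complex.Im R) w.
have pos (z : 'rV[R]_n) : 0 <= (z *m B *m z^T) 0 0.
  have [->|z0] := eqVneq z 0; first by rewrite !mul0mx mxE.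
  by have := Bp z^T; rewrite trmxK trmx_eq0 => /(_ z0)/ltW.
suff -> : dR 0 i = (u *m B *m u^T) 0 0 + (v *m B *m v^T) 0 0.
  by rewrite addr_ge0.
have wE : w = map_mx toC u + 'i *: map_mx toC v.
  by apply/rowP => j; rewrite !mxE {1}[P i j]complexE.
have wsE : w^t* = (map_mx toC u)^T - 'i *: (map_mx toC v)^T.
  apply/colP => j; rewrite !mxE; case: (P i j) => x y/=.
  by simpc.
clearbody u v; have := e1; rewrite wsE wE mulmxDl mulmxDl !mulmxBr.
rewrite -!scalemxAl -!scalemxAr.
rewrite scalerA -expr2 sqrCi scaleN1r opprK.
rewrite /BC !map_trmx -!map_mxM.
have -> : u *m B *m v^T = v *m B *m u^T.
  have tr11 (M : 'M[R]_1) : M^T = M.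
    by rewrite {1}(mx11_scalar M) tr_scalar_mx -mx11_scalar.
  by rewrite -[LHS]tr11 !trmx_mul trmxK Bs mulmxA.
rewrite addrA subrK -map_mxD mxE dE => /(congr1 (@complex.Re R)).
rewrite [in RHS]mxE /= => <-.
by rewrite !mxE.
Qed.

Lemma sqrt_spd n (B : 'M[R]_n.+1) : spd B ->
  exists2 p : {poly R},
    spd (horner_mx B p) & horner_mx B p *m horner_mx B p = B.
Proof.
move=> sB; have [P [d [uP d0 BE]]] := spd_spectral sB.
have hs (y : R) : 0 <= y -> Num.sqrt (Num.sqrt y) ^+ 2 ^+ 2 = y.
  by move=> y0; rewrite !sqr_sqrtr// sqrtr_ge0.
have [q qE] :=
  interp (fun x => Num.sqrt (Num.sqrt x)) [seq d 0 i | i : 'I_n.+1].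
have key : horner_mx B (q ^+ 4) = B.
  apply: (map_mx_inj (f := toC)); rewrite map_horner_mx BE.
  have stab : stablemx P (invmx P *m diag_mx (map_mx toC d) *m P).
    by apply: submx_full; rewrite row_full_unit.
  have fP : row_free P by rewrite row_free_unit.
  have h (M : 'M[R[i]]_n.+1) : invmx P *m M *m P = conjmx (invmx P) M.
    by rewrite conjumx ?unitmx_inv// invmxK.
  rewrite h horner_mx_conj ?row_free_unit ?unitmx_inv//; last first.
    by apply: submx_full; rewrite row_full_unit unitmx_inv.
  congr conjmx; rewrite horner_mx_diag; congr diag_mx; apply/rowP => i.
  rewrite !mxE horner_map/=; congr (_ %:C)%C.
  have -> : (q ^+ 4).[d 0 i] = q.[d 0 i] ^+ 2 ^+ 2 by rewrite horner_exp -exprM.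
  by rewrite qE; [exact: hs|by apply/mapP; exists i => //; rewrite mem_enum].
have SS : horner_mx B (q ^+ 2) *m horner_mx B (q ^+ 2) = B.
  by rewrite -[_ *m _]/(_ * _) -rmorphM/= -exprD key.
exists (q ^+ 2) => //; split; first by rewrite tr_horner; case: sB => ->.
move=> v v0; have uB := spd_unit sB.
pose Q := horner_mx B q.
have QQ : horner_mx B (q ^+ 2) = Q *m Q by rewrite rmorphXn/= expr2.
have QT : Q^T = Q by rewrite tr_horner; case: sB => ->.
have Qv : Q *m v != 0.
  apply: contra_neq v0 => Qv0; apply: (can_inj (mulKmx uB)).
  by rewrite mulmx0 -SS QQ -!mulmxA Qv0 !mulmx0.
rewrite QQ mulmxA -{1}QT -trmx_mul -mulmxA mxE.
under eq_bigr do rewrite mxE -expr2.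
rewrite lt_neqAle sumr_ge0 ?andbT; last by move=> *; exact: sqr_ge0.
apply: contra_neq Qv => /esym/eqP.
rewrite psumr_eq0 => [/allP h|*]; last exact: sqr_ge0.
apply/colP => i; rewrite [RHS]mxE; apply/eqP.
by have := h i (mem_index_enum i); rewrite sqrf_eq0.
Qed.

Lemma inv_sqrtmxP m (A : 'M[R]_m) : spd A ->
  spd (inv_sqrtmx A) /\ inv_sqrtmx A *m inv_sqrtmx A = invmx A.
Proof.
move=> /spd_inv sB.
suff [S hS] : exists S, spd S /\ S *m S = invmx A.
  by have := @xgetPex _ 0 [set S | spd S /\ S *m S = invmx A]; apply; exists S.
case: m A sB => [|n] A sB; last first.
  by have [p] := sqrt_spd sB; exists (horner_mx (invmx A) p).
by exists (invmx A); split=> //; rewrite !flatmx0.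
Qed.

Lemma inv_sqrtmx_uniq m (A S : 'M[R]_m) : spd A -> spd S ->
  S *m S = invmx A -> S = inv_sqrtmx A.
Proof.
move=> sA sS SS; have [sS' SS'] := inv_sqrtmxP sA; have sB := spd_inv sA.
suff [S0 uS0] : exists S0, forall S', spd S' -> S' *m S' = invmx A -> S' = S0.
  by rewrite (uS0 _ sS SS) (uS0 _ sS' SS').
case: m A S {sS sS' SS SS' sA} sB => [|n] A _ sB.
  by exists 0 => S' _ _; rewrite flatmx0.
have [p sp pp] := sqrt_spd sB; set S0 := horner_mx _ p in sp pp.
exists S0 => S' sS' SS'.
have c : comm_mx S' (invmx A) by rewrite /comm_mx -SS' mulmxA.
have c0 : S' *m S0 = S0 *m S' := comm_mx_horner p c.
have : (S' + S0) *m (S' - S0) = 0.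
  by rewrite mulmxDl !mulmxBr SS' pp c0 addrA subrK subrr.
have u : S' + S0 \in unitmx.
  apply: spd_unit; case: sS' sp => sym1 pos1 [sym2 pos2].
  split; first by rewrite linearD/= sym1 sym2.
  by move=> v v0; rewrite mulmxDr mulmxDl mxE addr_gt0 ?pos1 ?pos2.
move/(congr1 (mulmx (invmx (S' + S0)))); rewrite mulKmx// mulmx0 => /eqP.
by rewrite subr_eq0 => /eqP.
Qed.
End inv_sqrtmx_wf.

Section forward.
Context (R : realType) (a rad k : R) (m : nat).
Context (lam : 'I_m -> 'I_2 -> R) (x : 'I_m -> R * R) (l1 l2 : 'I_2).

Definition intOmega (f : R * R -> R) : R :=
  \int[@lebesgue2 R]_(y in (Omega0 a : set (plane R))) f y.

Definition forward (s : L2Omega a) : 'cV[R]_m := \col_j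
  let r l := euclid_norm (x j - ref_point rad lam j l) in
  let ReG y := complex.Re (green k (x j) y) in
  let ImG y := complex.Im (green k (x j) y) in
  let J l := besselJ0 (k * r l) in
  let Y l := besselY0 (k * r l) in
  Y l1 * Y l2 * intOmega (fun y => `|ReG y| ^+ 2 * s y)
  + J l1 * J l2 * intOmega (fun y => `|ImG y| ^+ 2 * s y)
  - (Y l1 * J l2 + Y l2 * J l1) * intOmega (fun y => ReG y * ImG y * s y).

End forward.

Section bayes.
Context (R : realType) d (H : measurableType d) (m : nat).

Definition posterior (prior : probability H R) (T : H -> 'cV[R]_m)
    (Sigma : 'M[R]_m) (F : 'cV[R]_m) (mu : probability H R) : Prop :=
  mu `<< prior /\
  exists2 c : R, 0 < c &
    'd (charge_of_finite_measure mu) '/d prior =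
      (fun s => (c * expR (- (2^-1 * cov_norm Sigma (T s - F) ^+ 2)))%:E)
    %[ae prior].

Definition hellinger (nu : {sigma_finite_measure set H -> \bar R})
    (mu mu' : probability H R) : R :=
  Num.sqrt (2^-1 * \int[nu]_s
    (Num.sqrt (fine ('d (charge_of_finite_measure mu) '/d nu s)) -
     Num.sqrt (fine ('d (charge_of_finite_measure mu') '/d nu s))) ^+ 2).

End bayes.

(* Main.v *)
Require Import Defs.
From HB Require Import structures.
From mathcomp Require Import all_boot all_order all_algebra complex.
From mathcomp Require Import all_classical all_reals all_analysis.
From mathcomp Require Import measurable_realfun.
From mathcomp Require Import ring lra.
Set Implicit Arguments.
Unset Strict Implicit.
Unset Printing Implicit Defensive.
Import Order.TTheory GRing.Theory Num.Theory.
Import numFieldNormedType.Exports.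
Local Open Scope classical_set_scope.
Local Open Scope ring_scope.

(** The posterior is the prior reweighted by a bounded positive likelihood.
Write [N] for the noise norm, [u_F s = N (T s - F)] for the misfit and
[w_F s = expR (- (u_F s ^+ 2 / 4))] for the square root of the likelihood
[expR (- (u_F s ^+ 2 / 2))].

Well-posedness.  Since [T] is Lipschitz on balls for [N], the misfit is
continuous, hence Borel measurable, and [w_F ^+ 2] is measurable with values in
]0, 1].  Its integral [Z_F] against the prior is then positive and finite
([Rintegral_weight_gt0]), so that [Z_F^-1 * w_F ^+ 2] is the density of a
probability measure ([reweighting_exists]); the total mass being 1, no other
constant is possible ([reweighting_integral]).

Stability.  The Hellinger distance compares the square roots of the densities,
and a change of reference measure leaves it unchanged: the prior is absolutely
continuous with respect to the posterior, hence with respect to any reference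
measure [nu], and both posterior densities with respect to [nu] are the prior
ones times that of the prior ([hellinger_densities]).  It is therefore enough
to bound the square roots [w_F / sqrt Z_F] pointwise.  The function
[expR (- (u ^+ 2 / 4))] is 1-Lipschitz on the nonnegative reals
([gaussian_weight_lipschitz]) and [N] satisfies the triangle inequality, so that
[w_F] is 1-Lipschitz in [F], uniformly in [s]; hence [Z_F] is 2-Lipschitz in
[F].  For data with [N F < r], [Z_F] is at least
[Z0], the integral of [expR (- ((N (T s) + r) ^+ 2 / 2))], which is positive and
independent of [F].  The inverse square root being Lipschitz away from 0, these
bounds give the constant [Z0^(-1/2) + 2 * Z0^(-3/2)]
([hellinger_reweighting]). *)

(** * The square root of the Gaussian likelihood *)

Section gaussian_weight.
Context {R : realType}.
Implicit Types u v : R.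

Definition gaussian_weight u : R := expR (- (u ^+ 2 / 4)).

Lemma gaussian_weight_gt0 u : 0 < gaussian_weight u.
Proof. exact: expR_gt0. Qed.

Lemma gaussian_weight_le1 u : gaussian_weight u <= 1.
Proof. by rewrite -expR0 ler_expR oppr_le0 divr_ge0// sqr_ge0. Qed.

Lemma gaussian_weight_sqr u : gaussian_weight u ^+ 2 = expR (- (2^-1 * u ^+ 2)).
Proof. by rewrite -expRM_natl; congr expR; field. Qed.

Lemma gaussian_weight_anti u v : 0 <= u -> u <= v ->
  gaussian_weight v <= gaussian_weight u.
Proof.
move=> u0 uv; rewrite ler_expR lerN2 ler_pM2r ?invr_gt0//.
by rewrite ler_sqr// nnegrE// (le_trans u0).
Qed.

(** Points at distance at least 1 are handled by [0 < gaussian_weight <= 1].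
For closer ones, [1 - expR (- t) <= t] turns the difference of squares
[(v - u) * (v + u)] into the bound
[(v - u) * (2 * u + (v - u)) / 4 * gaussian_weight u], where
[u * gaussian_weight u <= 1] compensates the growth of [u]. *)
Lemma gaussian_weight_lipschitz u v : 0 <= u -> 0 <= v ->
  `|gaussian_weight u - gaussian_weight v| <= `|u - v|.
Proof.
wlog uv : u v / u <= v => [H u0 v0|u0 _].
  have [uv|/ltW vu] := leP u v; first exact: H.
  by rewrite distrC (distrC u); exact: H.
rewrite ger0_norm ?subr_ge0 ?gaussian_weight_anti//.
rewrite distrC ger0_norm ?subr_ge0//.
have w0 := gaussian_weight_gt0 u; have w1 := gaussian_weight_le1 u.
have [far|near_] := leP 1 (v - u).
  by rewrite (le_trans _ far)// lerBlDr ler_wpDr// ltW// gaussian_weight_gt0.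
(* u <= 1 + u ^+ 2 / 4 <= expR (u ^+ 2 / 4), as (u / 2 - 1) ^+ 2 >= 0 *)
have uw : u * gaussian_weight u <= 1.
  rewrite /gaussian_weight expRN -ler_pdivlMr ?invr_gt0 ?expR_gt0//.
  rewrite mul1r invrK; apply: le_trans (expR_ge1Dx _).
  rewrite -subr_ge0 (_ : _ - _ = (u / 2 - 1) ^+ 2) ?sqr_ge0//.
  by field.
have -> : gaussian_weight v =
    gaussian_weight u * expR (- ((v - u) * (v + u) / 4)).
  by rewrite /gaussian_weight -expRD; congr expR; field.
have e1 := expR_ge1Dx (- ((v - u) * (v + u) / 4)).
rewrite -[X in X - _]mulr1 -mulrBr.
apply: (@le_trans _ _ (gaussian_weight u * ((v - u) * (v + u) / 4))).
  by apply: ler_wpM2l; [exact: ltW|lra].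
have -> : gaussian_weight u * ((v - u) * (v + u) / 4) =
  (v - u) * ((2 * (u * gaussian_weight u) + (v - u) * gaussian_weight u) / 4).
  by field.
rewrite -[leRHS]mulr1 ler_wpM2l ?subr_ge0//.
suff : (v - u) * gaussian_weight u <= 1 by lra.
by rewrite mulr_ile1// ?subr_ge0// ltW.
Qed.

End gaussian_weight.

(** * The noise norm *)

Section euclidean_norm.
Context {R : realType} {m : nat}.
Implicit Types v w : 'cV[R]_m.

(** With [A], [B] the two sums of squares and [C] the scalar product,
[A * y - C * x] has square norm [A * (A * B - C ^+ 2)]. *)
Lemma cauchy_schwarz_sum (I : finType) (x y : I -> R) :
  (\sum_i x i * y i) ^+ 2 <= (\sum_i x i ^+ 2) * (\sum_i y i ^+ 2).
Proof.
set A := \sum_i x i ^+ 2; set B := \sum_i y i ^+ 2; set C := \sum_i x i * y i.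
have A0 : 0 <= A by apply: sumr_ge0 => i _; exact: sqr_ge0.
have : 0 <= \sum_i (A * y i - C * x i) ^+ 2.
  by apply: sumr_ge0 => i _; exact: sqr_ge0.
have -> : \sum_i (A * y i - C * x i) ^+ 2 = A * (A * B - C ^+ 2).
  transitivity (\sum_i (A ^+ 2 * y i ^+ 2 - 2 * A * C * (x i * y i)
      + C ^+ 2 * x i ^+ 2)).
    by apply: eq_bigr => i _; ring.
  rewrite big_split/= sumrB -!mulr_sumr -/A -/B -/C; ring.
have [A00 _|An0] := eqVneq A 0; last first.
  by rewrite pmulr_rge0 ?lt_def ?An0// subr_ge0.
suff -> : C = 0 by rewrite expr0n mulr_ge0// sumr_ge0// => i _; exact: sqr_ge0.
apply: big1 => i _; have /psumr_eq0P x0 := A00.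
have /eqP := x0 (fun j _ => sqr_ge0 _) i isT.
by rewrite sqrf_eq0 => /eqP ->; rewrite mul0r.
Qed.

Lemma norm2_ge0 v : 0 <= norm2 v.
Proof. exact: sqrtr_ge0. Qed.

Lemma ler_norm2D v w : norm2 (v + w) <= norm2 v + norm2 w.
Proof.
have ss (z : 'cV[R]_m) : 0 <= \sum_i z i ord0 ^+ 2.
  by apply: sumr_ge0 => i _; exact: sqr_ge0.
rewrite -[leRHS]ger0_norm ?addr_ge0 ?norm2_ge0// -sqrtr_sqr.
rewrite ler_wsqrtr// sqrrD !sqr_sqrtr// -sqrtrM//.
rewrite [leLHS](_ : _ = \sum_i v i ord0 ^+ 2 +
    (\sum_i v i ord0 * w i ord0) *+ 2 + \sum_i w i ord0 ^+ 2); last first.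
  rewrite -sumrMnl -!big_split/=; apply: eq_bigr => i _.
  by rewrite mxE sqrrD.
rewrite lerD2r lerD2l lerMn2r/= (le_trans (ler_norm _))//.
by rewrite -sqrtr_sqr ler_wsqrtr// cauchy_schwarz_sum.
Qed.

Lemma norm2N v : norm2 (- v) = norm2 v.
Proof. by congr Num.sqrt; apply: eq_bigr => i _; rewrite mxE sqrrN. Qed.

Variable S : 'M[R]_m.

Lemma cov_norm_ge0 v : 0 <= cov_norm S v.
Proof. exact: norm2_ge0. Qed.

Lemma ler_cov_normD v w : cov_norm S (v + w) <= cov_norm S v + cov_norm S w.
Proof. by rewrite /cov_norm mulmxDr ler_norm2D. Qed.

Lemma cov_normN v : cov_norm S (- v) = cov_norm S v.
Proof. by rewrite /cov_norm mulmxN norm2N. Qed.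

Lemma ler_dist_cov_norm v w :
  `|cov_norm S v - cov_norm S w| <= cov_norm S (v - w).
Proof.
have tri x y : cov_norm S x - cov_norm S y <= cov_norm S (x - y).
  by rewrite lerBlDr (le_trans _ (ler_cov_normD _ _))// subrK.
by rewrite ler_norml tri andbT lerNl opprB -(cov_normN (v - w)) opprB tri.
Qed.

End euclidean_norm.

(** * Borel measurability *)

Section continuous_borel.
Context {R : realType} {V : normedModType R}.

Lemma continuous_borel_measurable (f : V -> R) :
  continuous f -> measurable_fun setT (f : borel V -> R).
Proof.
move=> /continuousP cf; apply: (measurability _ (RGenOpens.measurableE R)).
move=> _ [_ [a [b ->] <-]]; rewrite setTI.
by apply: sub_sigma_algebra; exact/cf/interval_open.
Qed.

Lemma lipschitz_on_balls_continuous (f : V -> R) :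
  (forall r, 0 < r -> exists2 K, 0 < K & forall s t,
     Num.max `|s| `|t| < r -> `|f s - f t| <= K * `|s - t|) ->
  continuous f.
Proof.
move=> flip s; apply/cvgrPdist_le => /= e e0.
have [K K0 fK] := flip (`|s| + 1) (ltr_wpDl (normr_ge0 s) ltr01).
near=> t; apply: le_trans (fK s t _) _.
  rewrite gt_max ltrDl ltr01/= -[t](subrK s) addrC.
  rewrite (le_lt_trans (ler_normD _ _))//.
  rewrite ltrD2l distrC; near: t; exact: cvgr_dist_lt.
rewrite mulrC -ler_pdivlMr//; near: t.
by apply: cvgr_dist_le => //; rewrite divr_gt0.
Unshelve. all: by end_near. Qed.

End continuous_borel.

Lemma measurable_gaussian_weight {R : realType} d (T : measurableType d)
    (u : T -> R) : measurable_fun setT u ->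
  measurable_fun setT (fun s => gaussian_weight (u s)).
Proof.
move=> mu; apply: (measurableT_comp (@measurable_expR R)).
apply: measurableT_comp => //; apply: measurable_funM => //.
exact: measurable_funX.
Qed.

(** * Probabilities with a density with respect to the prior *)

Section positive_density.
Context {R : realType} d {H : measurableType d} (P : probability H R).
Local Open Scope charge_scope.
Implicit Types (f g : H -> R) (mu : probability H R).

Lemma bounded_integrable (B : R) f : measurable_fun setT f ->
  (forall s, `|f s| <= B) -> P.-integrable setT (EFin \o f).
Proof.
move=> mf fB; apply: measurable_bounded_integrable => //.
  by rewrite ltey_eq fin_num_measure.
exists B; split=> [|y By s _]; first exact: num_real.
exact: le_trans (fB s) (ltW By).
Qed.

Lemma Rintegral_cst_probability (c : R) : \int[P]_s c = c.
Proof.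
rewrite -[RHS]mulr1; apply: etrans (Rintegral_cst _ _ _) _ => //.
by congr (c * _); have /(congr1 fine) := probability_setT P.
Qed.

Lemma null_of_integral0 f (A : set H) : measurable_fun setT f ->
  (forall s, 0 < f s) -> measurable A ->
  (\int[P]_(s in A) (f s)%:E = 0)%E -> P A = 0.
Proof.
move=> mf f0 mA If.
have mfA : measurable_fun A (EFin \o f).
  exact/measurable_EFinP/measurable_funTS.
have : (\int[P]_(s in A) `|(EFin \o f) s| = 0)%E.
  by rewrite -If; apply: eq_integral => s _; rewrite /= gtr0_norm.
move=> /(ae_eq_integral_abs P mA mfA)[N [mN N0 AN]].
apply: (subset_measure0 mA mN) N0 => s As; apply: AN => /(_ As)/eqP.
by rewrite eqe gt_eqF.
Qed.

Lemma Rintegral_weight_gt0 f : measurable_fun setT f ->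
  (forall s, 0 < f s <= 1) -> 0 < \int[P]_s f s.
Proof.
move=> mf f01.
have intf : P.-integrable setT (EFin \o f).
  apply: (@bounded_integrable 1) => // s.
  by have /andP[f0 f1] := f01 s; rewrite gtr0_norm.
rewrite lt_def Rintegral_ge0 ?andbT; last first.
  by move=> s _; have /andP[/ltW] := f01 s.
apply/negP => /eqP If0; have : P setT = 0.
  apply: (null_of_integral0 mf) => // [s|]; first by have /andP[] := f01 s.
  rewrite -[LHS]fineK; first by rewrite [fine _]If0.
  exact: integrable_fin_num.
by rewrite probability_setT => /eqP; rewrite onee_eq0.
Qed.

Lemma density_probability f : measurable_fun setT f -> (forall s, 0 <= f s) ->
  (\int[P]_s (f s)%:E = 1)%E ->
  exists mu : probability H R,
    forall A, measurable A -> mu A = (\int[P]_(s in A) (f s)%:E)%E.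
Proof.
move=> mf f0 f1.
pose nu (A : set H) := (\int[P]_(s in A) (f s)%:E)%E.
have nu0 : nu set0 = 0%E by exact: integral_set0.
have nu_ge0 A : (0 <= nu A)%E.
  by apply: integral_ge0 => s _; rewrite lee_fin.
have nu_sigma : semi_sigma_additive nu.
  apply: semi_sigma_additive_nng_induced => [|s]; last by rewrite lee_fin.
  exact/measurable_EFinP.
pose M1 := isMeasure.Build d H R nu nu0 nu_ge0 nu_sigma.
pose nuM : {measure set H -> \bar R} := HB.pack_for (Measure.type H R) nu M1.
pose M2 := Measure_isProbability.Build d H R nuM f1.
pose nuP : probability H R := HB.pack_for (probability H R) nu M1 M2.
by exists nuP.
Qed.

(** * Reweighting the prior *)

(** The posterior is the case where [g] is the likelihood; the normalization
constant is only required to exist. *)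
Definition reweighting g mu : Prop := mu `<< P /\
  exists2 c : R, 0 < c &
    'd (charge_of_finite_measure mu) '/d P = (fun s => (c * g s)%:E) %[ae P].

Lemma Radon_Nikodym_of_integral f mu : P.-integrable setT (EFin \o f) ->
  (forall A, measurable A -> mu A = (\int[P]_(s in A) (f s)%:E)%E) ->
  mu `<< P /\
  'd (charge_of_finite_measure mu) '/d P = EFin \o f %[ae P].
Proof.
move=> intf muE; have mf := measurable_int _ intf.
have muP : mu `<< P.
  apply/null_content_dominatesP => A mA PA0; rewrite [LHS]muE//.
  by apply: null_set_integral => //; exact: measurable_funTS.
split=> //; apply: integral_ae_eq => //.
  exact: Radon_Nikodym_integrable.
by move=> A _ mA; rewrite -Radon_Nikodym_integral//; exact: muE.
Qed.

Section weight.
Variable g : H -> R.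
Hypotheses (mg : measurable_fun setT g) (g01 : forall s, 0 < g s <= 1).

Local Lemma integrable_weight (c : R) :
  P.-integrable setT (EFin \o (fun s => c * g s)).
Proof.
apply: (@bounded_integrable `|c|); first exact: measurable_funM.
move=> s; have /andP[gs0 gs1] := g01 s.
by rewrite normrM ler_piMr// gtr0_norm.
Qed.

Local Lemma integral_weight (c : R) :
  (\int[P]_s (c * g s)%:E = (c * \int[P]_s g s)%:E)%E.
Proof.
have := integrable_weight 1.
under [X in _.-integrable _ X]eq_fun do rewrite /= mul1r.
move=> ig; rewrite -RintegralZl// fineK//.
by apply: integrable_fin_num => //; exact: integrable_weight.
Qed.

(** The normalization constant is forced by the total mass 1, so this formula
determines [mu]. *)
Lemma reweighting_integral mu : reweighting g mu ->
  forall A, measurable A ->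
  mu A = (\int[P]_(s in A) ((\int[P]_t g t)^-1 * g s)%:E)%E.
Proof.
move=> [muP [c c0 RN]].
have muE A : measurable A -> mu A = (\int[P]_(s in A) (c * g s)%:E)%E.
  move=> mA.
  rewrite [LHS](Radon_Nikodym_integral (nu := charge_of_finite_measure mu)
    muP mA).
  apply: ae_eq_integral => //; first exact: measurable_funTS.
    apply: measurable_funTS.
    exact: measurable_int (integrable_weight c).
  exact: ae_eq_subset RN.
suff -> : (\int[P]_t g t)^-1 = c by [].
have Z0 := Rintegral_weight_gt0 mg g01.
have /esym/eqP := muE _ measurableT.
rewrite integral_weight probability_setT eqe => /eqP cZ.
by rewrite -[RHS](mulfK (lt0r_neq0 Z0)) cZ mul1r.
Qed.

Lemma reweighting_exists : exists mu, reweighting g mu.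
Proof.
have Z0 := Rintegral_weight_gt0 mg g01.
have c0 : 0 < (\int[P]_t g t)^-1 by rewrite invr_gt0.
have [|s||mu muE] := @density_probability (fun s => (\int[P]_t g t)^-1 * g s).
- exact: measurable_funM.
- by have /andP[g0 _] := g01 s; rewrite mulr_ge0 ?ltW.
- by rewrite integral_weight mulVf ?gt_eqF.
have [muP RN] := Radon_Nikodym_of_integral (integrable_weight _) muE.
by exists mu; split=> //; exists (\int[P]_t g t)^-1.
Qed.

End weight.

(** * Hellinger distance of two reweightings *)

(** The density [f] being positive, [P `<< mu `<< nu]; with [h] the density of
[P] with respect to [nu], those of [mu] and [mu'] are [f * h] and [f' * h].
The integrand of the Hellinger distance is then
[(sqrt f - sqrt f') ^+ 2 * h], so that the integral over [nu] is the integral of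
[(sqrt f - sqrt f') ^+ 2] over the probability [P]. *)
Lemma hellinger_densities (nu : {sigma_finite_measure set H -> \bar R})
    mu mu' f f' (B : R) :
  P.-integrable setT (EFin \o f) -> P.-integrable setT (EFin \o f') ->
  (forall s, 0 < f s) -> (forall s, 0 <= f' s) ->
  (forall A, measurable A -> mu A = (\int[P]_(s in A) (f s)%:E)%E) ->
  (forall A, measurable A -> mu' A = (\int[P]_(s in A) (f' s)%:E)%E) ->
  mu `<< nu -> mu' `<< nu ->
  (forall s, `|Num.sqrt (f s) - Num.sqrt (f' s)| <= B) ->
  hellinger nu mu mu' <= B.
Proof.
move=> intf intf' f_gt0 f'_ge0 muE mu'E munu mu'nu fB.
have mf : measurable_fun setT f.
  exact/measurable_EFinP/(measurable_int _ intf).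
have mf' : measurable_fun setT f'.
  exact/measurable_EFinP/(measurable_int _ intf').
have Pnu : P `<< nu.
  apply: null_dominates_trans munu; apply/null_content_dominatesP => A mA muA0.
  by apply: (null_of_integral0 mf f_gt0 mA); rewrite -muE.
(* this version of the density is nonnegative and finite everywhere *)
pose h := Radon_Nikodym_SigmaFinite.f P nu.
have h0 s : (0 <= h s)%E by exact: Radon_Nikodym_SigmaFinite.f_ge0.
have hfin s : h s \is a fin_num by exact: Radon_Nikodym_SigmaFinite.f_fin_num.
have mh : measurable_fun setT h.
  exact: measurable_int (Radon_Nikodym_SigmaFinite.f_integrable Pnu).
have chain (q : H -> R) (rho : probability H R) :
    P.-integrable setT (EFin \o q) ->
    (forall s, 0 <= q s) -> rho `<< nu ->
    (forall A, measurable A -> rho A = (\int[P]_(s in A) (q s)%:E)%E) ->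
    'd (charge_of_finite_measure rho) '/d nu = (fun s => (q s)%:E * h s)%E
      %[ae nu].
  move=> intq q0 rhonu rhoE; apply: integral_ae_eq => //.
  - exact: Radon_Nikodym_integrable.
  - by apply: emeasurable_funM => //; exact: measurable_int intq.
  move=> A _ mA; rewrite -Radon_Nikodym_integral//.
  rewrite (Radon_Nikodym_SigmaFinite.change_of_variables Pnu)//.
  - exact: rhoE.
  - by apply: measurable_funTS; exact: measurable_int intq.
have B0 : 0 <= B by exact: le_trans (normr_ge0 _) (fB point).
have msq (q : H -> R) : measurable_fun setT q ->
    measurable_fun setT (fun s => Num.sqrt (q s)).
  move=> mq; apply: (measurableT_comp _ mq).
  by apply: continuous_measurable_fun; exact: sqrt_continuous.
pose phi s := (Num.sqrt (f s) - Num.sqrt (f' s)) ^+ 2.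
have mphi : measurable_fun setT phi.
  by apply: measurable_funX; apply: measurable_funB; exact: msq.
rewrite /hellinger -[leRHS]ger0_norm// -sqrtr_sqr ler_wsqrtr//.
set I := \int[nu]_s _.
suff IB : I <= B ^+ 2.
  have : 0 <= B ^+ 2 by exact: sqr_ge0.
  by lra.
suff -> : I = \int[P]_s phi s.
  rewrite -[leRHS](_ : \int[P]_s B ^+ 2 = _); last first.
    exact: Rintegral_cst_probability.
  have phiB s : phi s <= B ^+ 2.
    by rewrite /phi -real_normK ?num_real// ler_sqr ?nnegrE//.
  apply: le_Rintegral => //.
    apply: (@bounded_integrable (B ^+ 2)) => // s.
    by rewrite ger0_norm ?sqr_ge0.
  by apply: (@bounded_integrable `|B ^+ 2|) => //.
congr fine.
rewrite -(Radon_Nikodym_SigmaFinite.change_of_variables Pnu) => //; last 2 first.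
- by move=> s; rewrite lee_fin sqr_ge0.
- exact/measurable_EFinP.
have mRN (rho : probability H R) : rho `<< nu -> measurable_fun setT
    (fun s => Num.sqrt (fine ('d (charge_of_finite_measure rho) '/d nu s))).
  move=> rhonu; apply: msq; apply: measurableT_comp => //.
apply: ae_eq_integral => //.
- apply/measurable_EFinP/measurable_funX/measurable_funB; exact: mRN.
- by apply: emeasurable_funM => //; exact/measurable_EFinP.
have := chain _ _ intf (fun s => ltW (f_gt0 s)) munu muE.
have := chain _ _ intf' f'_ge0 mu'nu mu'E.
apply: filterS2 => s + + _ => /(_ Logic.I) -> /(_ Logic.I) ->.
rewrite -/h -(fineK (hfin s)) -!EFinM/= !sqrtrM ?(ltW (f_gt0 s))// -mulrBl.
by rewrite exprMn [X in _ * X]sqr_sqrtr// fine_ge0.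
Qed.

(** The difference of the square roots of the normalized densities splits as
[x * w - y * w' = x * (w - w') + (x - y) * w'] with [x = Z^(-1/2)] and
[y = Z'^(-1/2)].  The first term is at most [Z0^(-1/2) * D]; in the second one
[x - y] is controlled by [Z' - Z], itself at most [2 * D] because
[w ^+ 2 - w' ^+ 2 = (w - w') * (w + w')] with [w + w' <= 2]. *)
Lemma hellinger_reweighting (nu : {sigma_finite_measure set H -> \bar R})
    mu mu' (w w' : H -> R) (Z0 D : R) :
  measurable_fun setT w -> measurable_fun setT w' ->
  (forall s, 0 < w s <= 1) -> (forall s, 0 < w' s <= 1) ->
  0 < Z0 -> Z0 <= \int[P]_s w s ^+ 2 -> Z0 <= \int[P]_s w' s ^+ 2 ->
  (forall s, `|w s - w' s| <= D) ->
  reweighting (fun s => w s ^+ 2) mu -> reweighting (fun s => w' s ^+ 2) mu' ->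
  mu `<< nu -> mu' `<< nu ->
  hellinger nu mu mu' <=
    ((Num.sqrt Z0)^-1 + 2 * (Num.sqrt Z0)^-1 ^+ 3) * D.
Proof.
move=> mw mw' w01 w'01 Z0_gt0 Z0Z Z0Z' wD rw rw' munu mu'nu.
have D0 : 0 <= D := le_trans (normr_ge0 _) (wD point).
have mw2 (v : H -> R) : measurable_fun setT v ->
    measurable_fun setT (fun s => v s ^+ 2).
  exact: measurable_funX.
have w2 (v : H -> R) : (forall s, 0 < v s <= 1) -> forall s, 0 < v s ^+ 2 <= 1.
  move=> v01 s; have /andP[v0 v1] := v01 s.
  by rewrite exprn_gt0//= exprn_ile1// ltW.
have int2 (v : H -> R) : measurable_fun setT v -> (forall s, 0 < v s <= 1) ->
    P.-integrable setT (EFin \o (fun s => v s ^+ 2)).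
  move=> mv v01; apply: (@bounded_integrable 1) => [|s]; first exact: mw2.
  by have /andP[/gtr0_norm -> ] := w2 v v01 s.
pose Z := \int[P]_s w s ^+ 2; pose Z' := \int[P]_s w' s ^+ 2.
have Z_gt0 : 0 < Z := lt_le_trans Z0_gt0 Z0Z.
have Z'_gt0 : 0 < Z' := lt_le_trans Z0_gt0 Z0Z'.
have ZZ' : `|Z' - Z| <= 2 * D.
  rewrite /Z' /Z -RintegralB//; [|exact: int2|exact: int2].
  apply: le_trans (le_normr_Rintegral _ _) _ => //.
    have := integrableB measurableT (int2 _ mw' w'01) (int2 _ mw w01).
    by [].
  rewrite -[leRHS](_ : \int[P]_s (2 * D) = _); last first.
    exact: Rintegral_cst_probability.
  have diff s : `|w' s ^+ 2 - w s ^+ 2| <= 2 * D.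
    have /andP[w0 w1] := w01 s; have /andP[w'0 w'1] := w'01 s.
    rewrite subr_sqr normrM mulrC distrC ler_pM// gtr0_norm ?addr_gt0//.
    by lra.
  have md : measurable_fun setT (fun s => `|w' s ^+ 2 - w s ^+ 2|).
    by apply: measurableT_comp => //; apply: measurable_funB; exact: mw2.
  apply: le_Rintegral => //.
    by apply: (@bounded_integrable (2 * D)) => // s; rewrite normr_id.
  by apply: (@bounded_integrable `|2 * D|).
pose A := (Num.sqrt Z0)^-1.
pose x := (Num.sqrt Z)^-1; pose y := (Num.sqrt Z')^-1.
have bound (t : R) : Z0 <= t -> 0 < (Num.sqrt t)^-1 <= A.
  move=> Z0t; have t0 := lt_le_trans Z0_gt0 Z0t.
  by rewrite invr_gt0 sqrtr_gt0 t0/= lef_pV2 ?posrE ?sqrtr_gt0// ler_wsqrtr.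
have /andP[x0 xA] := bound _ Z0Z; have /andP[y0 yA] := bound _ Z0Z'.
rewrite -/A -/x -/y in x0 xA y0 yA *.
have xy : `|x - y| <= 2 * A ^+ 3 * D.
  (* the quotient y / (x + y) <= 1 isolates the sum of the square roots *)
  have -> : x - y = (Z' - Z) * (x * y * (x * (y / (x + y)))).
    have sZ : Num.sqrt Z ^+ 2 = Z by rewrite sqr_sqrtr// ltW.
    have sZ' : Num.sqrt Z' ^+ 2 = Z' by rewrite sqr_sqrtr// ltW.
    have p : 0 < Num.sqrt Z by rewrite sqrtr_gt0.
    have p' : 0 < Num.sqrt Z' by rewrite sqrtr_gt0.
    rewrite -{1}sZ -{1}sZ' /x /y; field.
    by rewrite !gt_eqF// addr_gt0.
  rewrite normrM.
  have q0 : 0 <= y / (x + y) by rewrite divr_ge0 ?addr_ge0// ltW.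
  have q1 : y / (x + y) <= 1.
    by rewrite ler_pdivrMr ?addr_gt0// mul1r lerDr ltW.
  have -> : 2 * A ^+ 3 * D = 2 * D * (A * A * (A * 1)) by ring.
  have x0' := ltW x0; have y0' := ltW y0.
  have xq0 := mulr_ge0 x0' q0; have xy0 := mulr_ge0 x0' y0'.
  rewrite (ger0_norm (mulr_ge0 xy0 xq0)).
  apply: ler_pM => //; first exact: mulr_ge0.
  by apply: ler_pM => //; exact: ler_pM.
apply: (@hellinger_densities nu mu mu' (fun s => Z^-1 * w s ^+ 2)
  (fun s => Z'^-1 * w' s ^+ 2)) => //.
- by apply: integrable_weight; [exact: mw2|exact: w2].
- by apply: integrable_weight; [exact: mw2|exact: w2].
- by move=> s; have /andP[? _] := w2 _ w01 s; rewrite mulr_gt0 ?invr_gt0.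
- by move=> s; rewrite mulr_ge0 ?sqr_ge0 ?invr_ge0 ?ltW.
- by apply: reweighting_integral => //; [exact: mw2|exact: w2].
- by apply: reweighting_integral => //; [exact: mw2|exact: w2].
move=> s; have /andP[w0 w1] := w01 s; have /andP[w'0 w'1] := w'01 s.
have sqrt_density (t q : R) : 0 < t -> 0 < q ->
    Num.sqrt (t^-1 * q ^+ 2) = (Num.sqrt t)^-1 * q.
  move=> t0 q0; rewrite sqrtrM ?invr_ge0 ?(ltW t0)// sqrtrV ?(ltW t0)//.
  by rewrite sqrtr_sqr gtr0_norm.
rewrite !sqrt_density// -/x -/y.
have -> : x * w s - y * w' s = x * (w s - w' s) + (x - y) * w' s by ring.
rewrite [leRHS]mulrDl (le_trans (ler_normD _ _))// !normrM lerD//.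
  by rewrite (gtr0_norm x0) ler_pM// ltW.
by rewrite -[leRHS]mulr1 ler_pM// gtr0_norm.
Qed.

End positive_density.

(** * Well-posedness of the posterior *)

Theorem theorem4p5 (R : realType) (a rad kstar k : R) (m : nat)
    (lam : 'I_m -> 'I_2 -> R) (x : 'I_m -> R * R) (l1 l2 : 'I_2)
    (Sigma : 'M[R]_m) (prior : probability (borel (L2Omega a)) R)
    (T := forward rad k lam x l1 l2 : L2Omega a -> 'cV[R]_m)
    (a_gt0 : 0 < a)
    (Omega0_disk : closure (Omega0 a) `<=` disk rad)
    (m_gt0 : (0 < m)%N)
    (kstar_gt0 : 0 < kstar)
    (k_wavenumber : wavenumbers a kstar k)
    (lam_choice : general_choice a rad kstar lam \/
                  explicit_choice a rad kstar k lam)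
    (x_arc : forall j, boundary_arc rad j (x j))
    (Sigma_spd : spd Sigma)
    (prior_gaussian : gaussian_measure prior)
    (T_growth : forall delta : R, 0 < delta -> exists M : R,
       forall s : L2Omega a,
         cov_norm Sigma (T s) <= expR (delta * `|s| ^+ 2 + M))
    (T_lipschitz : forall r : R, 0 < r -> exists2 K : R, 0 < K &
       forall s1 s2 : L2Omega a, Num.max `|s1| `|s2| < r ->
         cov_norm Sigma (T s1 - T s2) <= K * `|s1 - s2|) :
  (forall F : 'cV[R]_m,
     exists mu : probability (borel (L2Omega a)) R,
       posterior prior T Sigma F mu /\
       forall mu' : probability (borel (L2Omega a)) R,
         posterior prior T Sigma F mu' ->
         forall A, measurable A -> mu' A = mu A) /\
  (forall r : R, 0 < r -> exists2 C : R, 0 < C &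
     forall F F' : 'cV[R]_m,
       Num.max (cov_norm Sigma F) (cov_norm Sigma F') < r ->
     forall mu mu' : probability (borel (L2Omega a)) R,
       posterior prior T Sigma F mu -> posterior prior T Sigma F' mu' ->
     forall nu : {sigma_finite_measure set (borel (L2Omega a)) -> \bar R},
       mu `<< nu -> mu' `<< nu ->
       hellinger nu mu mu' <= C * cov_norm Sigma (F - F')).
Proof.
set N := cov_norm Sigma in T_growth T_lipschitz *.
pose u F (s : borel (L2Omega a)) := N (T s - F).
have u_ge0 F s : 0 <= u F s by exact: cov_norm_ge0.
have u_measurable F : measurable_fun setT (u F).
  apply: (@continuous_borel_measurable _ (L2Omega a)).
  apply: lipschitz_on_balls_continuous => r r0.
  have [K K0 TK] := T_lipschitz r r0; exists K => // s t st.
  apply: le_trans (TK s t st); rewrite /u.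
  apply: le_trans (ler_dist_cov_norm _ _ _) _.
  by rewrite opprB addrA subrK.
pose w F s := gaussian_weight (u F s).
have w_measurable F : measurable_fun setT (w F).
  exact: measurable_gaussian_weight.
have w01 F s : 0 < w F s <= 1.
  by rewrite gaussian_weight_gt0 gaussian_weight_le1.
have posteriorE F mu : posterior prior T Sigma F mu =
    reweighting prior (fun s => w F s ^+ 2) mu.
  suff -> : (fun s => w F s ^+ 2) = (fun s => expR (- (2^-1 * u F s ^+ 2))).
    by [].
  by apply/funext => s; exact: gaussian_weight_sqr.
have w2_measurable F : measurable_fun setT (fun s => w F s ^+ 2).
  exact: measurable_funX.
have w2_01 F s : 0 < w F s ^+ 2 <= 1.
  by have /andP[w0 w1] := w01 F s; rewrite exprn_gt0//= exprn_ile1// ltW.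
split=> [F|r r0].
  have [mu mu_post] := reweighting_exists prior (w2_measurable F) (w2_01 F).
  exists mu; rewrite posteriorE; split=> // mu'.
  rewrite posteriorE => mu'_post A mA.
  have massE := reweighting_integral (w2_measurable F) (w2_01 F).
  by rewrite (massE _ _ mu_post A mA) (massE _ _ mu'_post A mA).
(* a lower bound of w F, uniform over the data with N F < r *)
pose v s := gaussian_weight (u 0 s + r).
have v_measurable : measurable_fun setT (fun s => v s ^+ 2).
  by apply: measurable_funX; apply: measurable_gaussian_weight;
    exact: measurable_funD.
have v01 s : 0 < v s ^+ 2 <= 1.
  by rewrite exprn_gt0 ?gaussian_weight_gt0//= exprn_ile1//
    ?gaussian_weight_le1// ltW// gaussian_weight_gt0.
pose Z0 := \int[prior]_s v s ^+ 2.
have Z0_gt0 : 0 < Z0 by exact: Rintegral_weight_gt0.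
have Z0_le F : N F < r -> Z0 <= \int[prior]_s w F s ^+ 2.
  move=> Fr; apply: le_Rintegral => //.
  - by apply: (@bounded_integrable _ _ _ _ 1) => // s;
      have /andP[/gtr0_norm ->] := v01 s.
  - by apply: (@bounded_integrable _ _ _ _ 1) => // s;
      have /andP[/gtr0_norm ->] := w2_01 F s.
  move=> s _; rewrite ler_sqr ?nnegrE; try exact/ltW/gaussian_weight_gt0.
  apply: gaussian_weight_anti => //; rewrite /u subr0.
  apply: le_trans (ler_cov_normD _ _ _) _.
  by rewrite cov_normN lerD2l ltW.
exists ((Num.sqrt Z0)^-1 + 2 * (Num.sqrt Z0)^-1 ^+ 3).
  by rewrite addr_gt0// ?mulr_gt0// ?exprn_gt0// invr_gt0 sqrtr_gt0.
move=> F F'; rewrite gt_max => /andP[Fr F'r] mu mu'; rewrite !posteriorE.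
move=> mu_post mu'_post nu munu mu'nu.
apply: (@hellinger_reweighting _ _ _ prior nu mu mu' (w F) (w F')) => //.
- exact: Z0_le.
- exact: Z0_le.
move=> s.
apply: le_trans (gaussian_weight_lipschitz (u_ge0 F s) (u_ge0 F' s)) _.
apply: le_trans (ler_dist_cov_norm _ _ _) _.
by rewrite opprB addrCA addrAC subrr add0r -cov_normN opprB.
Qed.
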